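(* Let $n=p+q$, let $h^1,\dots,h^n:\mathbb{R}^{p,q}\to\mathcal{C}\ell_{\circledS}(p,q)$ be a Clifford field vector and $C_1,\dots,C_n:\mathbb{R}^{p,q}\to\mathcal{C}\ell_{\circledS}(p,q)$ (all with continuous partial derivatives up to second order) satisfying $\partial_\mu h_\rho-[C_\mu,h_\rho]=0$ for all $\mu,\rho$; let $\sigma\in\mathbb{C}$, $\varepsilon=4(n-1)\sigma^3$, $B_\mu=\sigma h_\mu+C_\mu$ and $G_{\mu\nu}=\partial_\mu B_\nu-\partial_\nu B_\mu-[B_\mu,B_\nu]$, so that $(B_\mu,G_{\mu\nu},h^\nu)$ satisfy $\partial_\mu B_\nu-\partial_\nu B_\mu-[B_\mu,B_\nu]=G_{\mu\nu}$ and $\partial_\mu G^{\mu\nu}-[B_\mu,G^{\mu\nu}]=\varepsilon h^\nu$. Let $S:\mathbb{R}^{p,q}\to\mathcal{C}\ell(p,q)$ be smooth with invertible values and $S^{-1}\partial_\mu S\in\mathcal{C}\ell_{\circledS}(p,q)$ for all $\mu$. Define $\acute B_\mu=S^{-1}B_\mu S-S^{-1}\partial_\mu S$, $\acute G_{\mu\nu}=S^{-1}G_{\mu\nu}S$, $\acute h^\nu=S^{-1}h^\nu S$, $\acute C_\mu=S^{-1}C_\mu S-S^{-1}\partial_\mu S$. Then $\acute B_\mu=\sigma\acute h_\mu+\acute C_\mu$ and $$\partial_\mu \acute B_\nu-\partial_\nu \acute B_\mu-[\acute B_\mu,\acute B_\nu]=\acute G_{\mu\nu},\qquad \partial_\mu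 \acute G^{\mu\nu}-[\acute B_\mu,\acute G^{\mu\nu}]=\varepsilon \acute h^\nu.$$
   Context: $\mathbb{R}^{p,q}$ is $\mathbb{R}^n$ with Cartesian coordinates $x^\mu$, $\partial_\mu=\partial/\partial x^\mu$, metric $\eta=(\eta_{\mu\nu})=(\eta^{\mu\nu})=\mathrm{diag}(1,\dots,1,-1,\dots,-1)$ ($p$ ones, $q$ minus ones); indices are lowered/raised with $\eta$ and Einstein summation is used. $\mathcal{C}\ell(p,q)$ is the complex Clifford algebra with identity $e$ and generators $e^1,\dots,e^n$, $e^ae^b+e^be^a=2\eta^{ab}e$, with basis $e$, $e^{a_1\dots a_k}=e^{a_1}\cdots e^{a_k}$ ($a_1<\dots<a_k$); functions into it are differentiated coefficientwise. $[U,V]=UV-VU$. $\mathrm{Tr}(U)$ is the coefficient of $e$. The center is spanned by $e$ for even $n$ and by $e,e^{1\dots n}$ for odd $n$; $\mathcal{C}\ell_{\circledS}(p,q)$ is the set of elements with zero projection onto the center. A Clifford field vector is a collection $h^\mu:\mathbb{R}^{p,q}\to\mathcal{C}\ell(p,q)$, $\mu=1,\dots,n$, with $h^\mu h^\nu+h^\nu h^\mu=2\eta^{\mu\nu}e$ and $\mathrm{Tr}(h^1\cdots h^n)=0$ at every point. *)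

(* Defs.v *)
From HB Require Import structures.
From mathcomp Require Import all_boot all_order all_algebra.
From mathcomp Require Import complex.
From mathcomp Require Import reals.

Set Implicit Arguments.
Unset Strict Implicit.
Unset Printing Implicit Defensive.

Import Order.TTheory GRing.Theory Num.Theory.
Local Open Scope ring_scope.

Section Clifford.
Variable R : realType.
Variables p q : nat.
Local Notation n := (p + q)%N.

(* The complex Clifford algebra Cl(p,q): an element is the family of its
   complex coefficients in the basis e_A = e^{a_1}...e^{a_k}, a_1<...<a_k,
   A = {a_1,...,a_k} (e_set0 = e, the identity). Indices are 0..n-1. *)
Definition Cl := {ffun {set 'I_n} -> R[i]}.

Definition eta (a b : 'I_n) : R[i] :=
  if a == b then (if (a < p)%N then 1 else -1) else 0.

(* e_A e_B = clsign A B e_{A symdiff B} *)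
Definition clsign (A B : {set 'I_n}) : R[i] :=
  (-1) ^+ #|[set ab : 'I_n * 'I_n | [&& ab.1 \in A, ab.2 \in B & (ab.2 < ab.1)%N]]|
  * \prod_(c in A :&: B) eta c c.

Definition clbasis (A : {set 'I_n}) : Cl := [ffun B => (B == A)%:R].

Definition clmul (U V : Cl) : Cl :=
  \sum_(A : {set 'I_n}) \sum_(B : {set 'I_n})
     (U A * V B * clsign A B) *: clbasis ((A :\: B) :|: (B :\: A)).

Definition clone : Cl := clbasis set0.
Definition clgen (a : 'I_n) : Cl := clbasis [set a].

Definition clTr (U : Cl) : R[i] := U set0.

Definition clcomm (U V : Cl) : Cl := clmul U V - clmul V U.

(* Cl_S(p,q): zero projection onto the center, which is spanned by e for
   even n and by e, e^{1..n} for odd n. *)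
Definition in_ClS (U : Cl) : Prop :=
  U set0 = 0 /\ (odd n -> U [set: 'I_n] = 0).

End Clifford.

From mathcomp Require Import all_classical all_reals all_analysis.
Import numFieldNormedType.Exports.

Section Calculus.
Variable R : realType.
Variables p q : nat.
Local Notation n := (p + q)%N.
Local Notation Cl := (Cl R p q).
Local Notation eta := (@eta R p q).
Local Notation clmul := (@clmul R p q).
Local Notation clone := (clone R p q).

Definition ev (mu : 'I_n) : 'rV[R]_n := delta_mx 0 mu.

Definition rpd (mu : 'I_n) (f : 'rV[R]_n -> R) : 'rV[R]_n -> R :=
  fun x => 'D_(ev mu) f x.

Definition pd (mu : 'I_n) (F : 'rV[R]_n -> Cl) : 'rV[R]_n -> Cl :=
  fun x => [ffun A => Complex (rpd mu (fun y => complex.Re (F y A)) x)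
                              (rpd mu (fun y => complex.Im (F y A)) x)].

Definition rC2 (f : 'rV[R]_n -> R) : Prop :=
  [/\ continuous f,
      (forall mu x, derivable f x (ev mu)),
      (forall mu, continuous (rpd mu f)),
      (forall mu nu x, derivable (rpd mu f) x (ev nu))
    & (forall mu nu, continuous (rpd nu (rpd mu f)))].

Definition rsmooth (f : 'rV[R]_n -> R) : Prop :=
  forall l : seq 'I_n,
    continuous (foldr rpd f l) /\
    (forall mu x, derivable (foldr rpd f l) x (ev mu)).

Definition coeffwise (P : ('rV[R]_n -> R) -> Prop) (F : 'rV[R]_n -> Cl) : Prop :=
  forall A, P (fun y => complex.Re (F y A)) /\ P (fun y => complex.Im (F y A)).

Definition clC2 := coeffwise rC2.
Definition clsmooth := coeffwise rsmooth.

Definition clifford_field_vector (h : 'I_n -> 'rV[R]_n -> Cl) : Prop :=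
  forall x,
    (forall mu nu, clmul (h mu x) (h nu x) + clmul (h nu x) (h mu x)
                   = (2%:R * eta mu nu) *: clone) /\
    clTr (\big[clmul/clone]_(mu < n) h mu x) = 0.

Definition lower1 (F : 'I_n -> 'rV[R]_n -> Cl) (mu : 'I_n) : 'rV[R]_n -> Cl :=
  fun x => \sum_(nu < n) eta mu nu *: F nu x.

Definition raise2 (G : 'I_n -> 'I_n -> 'rV[R]_n -> Cl) (mu nu : 'I_n)
  : 'rV[R]_n -> Cl :=
  fun x => \sum_(a < n) \sum_(b < n) (eta mu a * eta nu b) *: G a b x.

End Calculus.

(* Main.v *)
(* Mixed partial derivatives of h commute, so the curvature F of the connection
   C commutes with every h^mu.  The products of the h^mu span the Clifford
   algebra, so F is central; as it has no component in the center, F = 0.  Hence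
   G_{mu nu} = - sigma^2 [h_mu, h_nu].  By the Jacobi identity this is parallel
   for C, and the remaining term of the Yang-Mills equation is
   sigma^3 [h_mu, [h^mu, h^nu]] = 4 (n - 1) sigma^3 h^nu.  Since S^-1 is
   differentiable, the gauge transformation conjugates the curvature and the
   covariant derivative by S. *)
Require Import Defs.
From HB Require Import structures.
From mathcomp Require Import all_boot all_order all_algebra.
From mathcomp Require Import complex.
From mathcomp Require Import ring.
From mathcomp Require Import all_classical all_reals all_analysis.
Import Order.TTheory GRing.Theory Num.Theory.
Import numFieldNormedType.Exports.

Set Implicit Arguments.
Unset Strict Implicit.
Unset Printing Implicit Defensive.

Local Open Scope ring_scope.

(** * Symmetric differences of index sets *)

Section SymmetricDifference.
Variable T : finType.
Implicit Types A B D : {set T}.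

(** Basis elements are indexed by subsets and e_A e_B is a sign times the basis element of the
    symmetric difference, so commutation and centrality become parity questions about subsets.
    Spanning is the delicate point: for odd n the product h^1...h^n commutes with every h^mu and
    could be a multiple of e (as for n = 1, h^1 = e), and then the products of the h^mu would span
    only half of the algebra. The condition Tr(h^1...h^n) = 0 excludes this: every nonempty product
    becomes traceless, which gives linear independence. The curvature has no central component
    because the coefficients of e and, for odd n, of e^{1...n} vanish on every commutator. The
    constant 4(n-1) counts the n-1 indices mu other than nu, each with [h_mu, [h^mu, h^nu]] = 4 h^nu
    without summation. Partial derivatives are total functions here, so a product rule is available
    only with a proof of differentiability; values of derivatives are therefore carried together
    with their existence, and differentiability of S^-1 has to be derived from that of S. *)

Definition symd A B : {set T} := (A :\: B) :|: (B :\: A).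

Lemma in_symd A B x : (x \in symd A B) = (x \in A) (+) (x \in B).
Proof. by rewrite !inE; case: (x \in A); case: (x \in B). Qed.

Lemma symdA A B D : symd A (symd B D) = symd (symd A B) D.
Proof. by apply/setP => x; rewrite !in_symd addbA. Qed.

Lemma symdK A : involutive (symd A).
Proof. by move=> B; apply/setP => x; rewrite !in_symd addbA addbb. Qed.

Lemma symdC A B : symd A B = symd B A.
Proof. by apply/setP => x; rewrite !in_symd addbC. Qed.

Lemma symdCA A B D : symd A (symd B D) = symd B (symd A D).
Proof. by rewrite !symdA [symd A B]symdC. Qed.

Lemma symdd A : symd A A = finset.set0.
Proof. by apply/setP => x; rewrite in_symd addbb inE. Qed.

Lemma symd0 A : symd A finset.set0 = A.
Proof. by apply/setP => x; rewrite in_symd inE addbF. Qed.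

Lemma symd_eq0 A B : (symd A B == finset.set0) = (A == B).
Proof.
apply/eqP/eqP => [AB0|->]; last exact: symdd.
apply/setP => x; move/setP/(_ x): AB0; rewrite in_symd inE.
by case: (x \in A); case: (x \in B).
Qed.

Lemma prod_symd (K : comPzRingType) (f : T -> K) A B :
  (forall x, f x ^+ 2 = 1) ->
  \prod_(x in symd A B) f x = \prod_(x in A) f x * \prod_(x in B) f x.
Proof.
move=> f2; rewrite !(big_mkcond (fun x => x \in _)) -big_split /=.
apply: eq_bigr => x _; rewrite in_symd.
case: (x \in A); case: (x \in B); rewrite /= ?mul1r ?mulr1 //.
by rewrite -expr2 f2.
Qed.

(** The generator e^a commutes with e_D up to the sign (-1)^|D \ a|, so this singles out the central
    basis elements. A member of D makes |D| odd, and then a point b outside D would make |D \ b| =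
    |D| odd. *)
Lemma even_all_setD1 D : (forall a, ~~ odd #|D :\ a|) ->
  D = finset.set0 \/ (odd #|T| /\ D = finset.setT).
Proof.
move=> evenD; have [->|[a aD]] := set_0Vmem D; [by left | right].
have oddD : odd #|D| by rewrite (cardsD1 a) aD add1n /= evenD.
have DT : D = finset.setT.
  apply/setP => b; rewrite inE; apply/negP => /negP bD.
  by move: (evenD b) oddD; rewrite (cardsD1 b D) (negbTE bD) => /negbTE->.
by split=> //; rewrite -cardsT -DT.
Qed.

End SymmetricDifference.

(** * Signs and associativity of the Clifford product *)

Section CliffordProduct.
Variables (R : realType) (p q : nat).
Local Notation n := (p + q)%N.
Local Notation Cl := (Cl R p q).
Local Notation clsign := (@clsign R p q).
Implicit Types (A B D : {set 'I_n}) (U V W : Cl).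

Lemma eta_sqr a : @Defs.eta R p q a a ^+ 2 = 1.
Proof. by rewrite /Defs.eta eqxx; case: ifP; rewrite ?sqrrN expr1n. Qed.

Lemma eta_eq0 (a b : 'I_n) : a != b -> @Defs.eta R p q a b = 0.
Proof. by rewrite /Defs.eta => /negbTE->. Qed.

(** The factor that one pair, e^a from the left word and e^b from the right one, contributes when
    e_A e_B is sorted: -1 for an inversion, the square of e^a for a coincidence. *)
Definition gensign (a b : 'I_n) : R[i] :=
  if (b < a)%N then -1 else if a == b then @Defs.eta R p q a a else 1.

Lemma gensign_sqr a b : gensign a b ^+ 2 = 1.
Proof.
rewrite /gensign; case: ifP => _; first by rewrite sqrrN expr1n.
by case: ifP => _; rewrite ?eta_sqr ?expr1n.
Qed.

(* [clsign] is bimultiplicative for the symmetric difference, which gives the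
   cocycle identity behind associativity. *)
Lemma clsignE A B : clsign A B = \prod_(a in A) \prod_(b in B) gensign a b.
Proof.
have splits a b : gensign a b =
    (-1) ^+ (b < a)%N * (if a == b then @Defs.eta R p q a a else 1).
  by rewrite /gensign; case: eqVneq => [->|_]; rewrite ?ltnn ?expr0 ?mul1r //
    mulr1; case: ifP.
under eq_bigr do under eq_bigr do rewrite splits.
under eq_bigr do rewrite big_split.
rewrite big_split /= /clsign; congr (_ * _).
  rewrite pair_big_dep /= -expr_sum; congr (_ ^+ _).
  rewrite -sum1_card big_mkcond [RHS]big_mkcond /=; apply: eq_bigr => -[a b] _.
  by rewrite inE /=; case: (a \in A); case: (b \in B).
rewrite (eq_bigl (fun c => (c \in A) && (c \in B))); last first.
  by move=> c; rewrite inE.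
rewrite big_mkcondr; apply: eq_bigr => a _; rewrite -big_mkcondr /=.
case: ifPn => aB; last first.
  rewrite big1 // => b /andP[bB /eqP ab].
  by rewrite ab bB in aB.
rewrite (big_pred1 a) // => b /=; rewrite [RHS]eq_sym.
by case: eqVneq => [<-|_]; rewrite ?aB ?andbF.
Qed.

Lemma clsign_symdl A B D : clsign (symd A B) D = clsign A D * clsign B D.
Proof.
rewrite !clsignE; apply: prod_symd => a.
by rewrite -prodrXl big1 // => b _; rewrite gensign_sqr.
Qed.

Lemma clsign_symdr A B D : clsign D (symd A B) = clsign D A * clsign D B.
Proof.
rewrite !clsignE exchange_big [X in _ = X * _]exchange_big.
rewrite [X in _ = _ * X]exchange_big; apply: prod_symd => a.
by rewrite -prodrXl big1 // => b _; rewrite gensign_sqr.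
Qed.

Lemma clsign_sqr A B : clsign A B ^+ 2 = 1.
Proof.
rewrite !clsignE -prodrXl big1 // => a _.
by rewrite -prodrXl big1 // => b _; rewrite gensign_sqr.
Qed.

Lemma clsign0l A : clsign finset.set0 A = 1.
Proof. by rewrite clsignE big_set0. Qed.

Lemma clsign0r A : clsign A finset.set0 = 1.
Proof. by rewrite clsignE big1 // => a _; rewrite big_set0. Qed.

(** Moving e^a through e_D costs -1 for each factor of e_D other than e^a itself. *)
Lemma clsign1C a D :
  clsign [set a] D = (-1) ^+ #|D :\ a| * clsign D [set a].
Proof.
rewrite !clsignE big_set1 -prodr_const.
under [X in _ * X]eq_bigr do rewrite big_set1.
rewrite (big_mkcond (fun x => x \in D :\ a)) (big_mkcond (fun x => x \in D)).
rewrite [X in _ * X](big_mkcond (fun x => x \in D)) -big_split /=.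
apply: eq_bigr => b _; rewrite !inE.
case: eqVneq => [->|ab] /=; first by rewrite mul1r.
case: (b \in D); rewrite ?mulr1 // /gensign [a == b]eq_sym (negbTE ab).
by case: ltngtP => // [||/val_inj eqab]; rewrite ?mulr1 ?mulN1r ?opprK //
  eqab eqxx in ab *.
Qed.

(** Against the full set each generator meets n - 1 others, an even number when n is odd; the
    product form of [clsign] extends this to every A. *)
Lemma clsign_symC D : D = finset.set0 \/ (odd n /\ D = finset.setT) ->
  forall A, clsign A D = clsign D A.
Proof.
case=> [->|[oddn ->]] A; first by rewrite clsign0l clsign0r.
rewrite !clsignE [RHS]exchange_big /=.
apply: eq_bigr => a _.
have := clsign1C a finset.setT; rewrite !clsignE big_set1 => ->.
under eq_bigr do rewrite big_set1.
have -> : #|[set: 'I_n] :\ a| = n.-1.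
  have := cardsD1 a [set: 'I_n]; rewrite cardsT card_ord inE add1n.
  by move/(congr1 predn).
by rewrite -signr_odd -subn1 oddB ?(leq_trans _ (ltn_ord a)) // oddn mul1r.
Qed.

(** For given A only B = [symd A D] makes e_A e_B proportional to e_D, so the double sum collapses
    to a single one. *)
Lemma clmulE U V D : clmul U V D =
  \sum_A U A * V (symd A D) * clsign A (symd A D).
Proof.
rewrite /clmul sum_ffunE; apply: eq_bigr => A _; rewrite sum_ffunE.
rewrite (bigD1 (symd A D)) //= big1 ?addr0 => [|B neqB].
  rewrite !ffunE -/(symd A (symd A D)) symdK eqxx.
  by rewrite [_ *: _]mulr1.
rewrite !ffunE -/(symd A B); case: eqVneq => [E|_]; last by rewrite scaler0.
by rewrite E symdK eqxx in neqB.
Qed.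

Lemma clmulA : associative (@clmul R p q).
Proof.
move=> U V W; apply/ffunP => E; rewrite !clmulE.
under eq_bigr do rewrite clmulE mulr_sumr mulr_suml.
under [RHS]eq_bigr do rewrite clmulE !mulr_suml.
rewrite [RHS]exchange_big /=; apply: eq_bigr => A _.
(* After this substitution both sides carry [U A], [V (symd A D)] and [W (symd D E)], so that only
   signs remain to be compared. *)
rewrite (reindex_inj (can_inj (symdK A))); apply: eq_bigr => D _ /=.
rewrite symdA -[symd (symd A D) A]symdA [symd D A]symdC symdK.
rewrite !(clsign_symdr, clsign_symdl).
have := clsign_sqr A D; have := clsign_sqr A E.
set x := clsign A E; set y := clsign A D => x2 y2.
ring: x2 y2.
Qed.

End CliffordProduct.
(* [Cl] is a finite function space, whose canonical structures must not be
   extended with the Clifford product; [clalg] is the same type seen as an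
   algebra.  Its operations are locked, for otherwise failing unification
   problems unfold them down to enumerations of [{set 'I_(p + q)}]. *)
Definition clalg (R : realType) (p q : nat) : Type := Cl R p q.

HB.lock Definition clalg_zero (R : realType) (p q : nat) : clalg R p q :=
  [ffun=> 0].
HB.lock Definition clalg_opp (R : realType) (p q : nat)
  (U : clalg R p q) : clalg R p q := [ffun A => - U A].
HB.lock Definition clalg_add (R : realType) (p q : nat)
  (U V : clalg R p q) : clalg R p q := [ffun A => U A + V A].
HB.lock Definition clalg_scale (R : realType) (p q : nat)
  (c : R[i]) (U : clalg R p q) : clalg R p q := [ffun A => c * U A].
HB.lock Definition clalg_one (R : realType) (p q : nat) : clalg R p q :=
  clone R p q.
HB.lock Definition clalg_mul (R : realType) (p q : nat)
  (U V : clalg R p q) : clalg R p q := clmul U V.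

(** * Ring and algebra structure on the Clifford algebra *)

Section CliffordAlgebra.
Variables (R : realType) (p q : nat).
Local Notation n := (p + q)%N.
Local Notation clsign := (@clsign R p q).
Local Notation clalg := (clalg R p q).
Implicit Types (A B D : {set 'I_n}) (U V W : clalg) (c : R[i]).

HB.instance Definition _ := Choice.copy clalg {ffun {set 'I_n} -> R[i]}.

Fact clalg_zeroE A : clalg_zero R p q A = 0.
Proof. by rewrite clalg_zero.unlock ffunE. Qed.
Fact clalg_oppE U A : clalg_opp U A = - U A.
Proof. by rewrite clalg_opp.unlock ffunE. Qed.
Fact clalg_addE U V A : clalg_add U V A = U A + V A.
Proof. by rewrite clalg_add.unlock ffunE. Qed.
Fact clalg_scaleE c U A : clalg_scale c U A = c * U A.
Proof. by rewrite clalg_scale.unlock ffunE. Qed.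

Fact clalg_addA : associative (@clalg_add R p q).
Proof. by move=> U V W; apply/ffunP => A; rewrite !clalg_addE addrA. Qed.
Fact clalg_addC : commutative (@clalg_add R p q).
Proof. by move=> U V; apply/ffunP => A; rewrite !clalg_addE addrC. Qed.
Fact clalg_add0 : left_id (clalg_zero R p q) (@clalg_add R p q).
Proof.
by move=> U; apply/ffunP => A; rewrite clalg_addE clalg_zeroE add0r.
Qed.
Fact clalg_addN :
  left_inverse (clalg_zero R p q) (@clalg_opp R p q) (@clalg_add R p q).
Proof.
move=> U; apply/ffunP => A.
by rewrite clalg_addE clalg_oppE clalg_zeroE addNr.
Qed.

HB.instance Definition _ := GRing.isZmodule.Build clalg
  clalg_addA clalg_addC clalg_add0 clalg_addN.

Lemma clalgDE U V A : (U + V) A = U A + V A. Proof. exact: clalg_addE. Qed.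
Lemma clalgNE U A : (- U) A = - U A. Proof. exact: clalg_oppE. Qed.
Lemma clalg0E A : (0 : clalg) A = 0. Proof. exact: clalg_zeroE. Qed.

Fact clalg_scaleA a b U :
  clalg_scale a (clalg_scale b U) = clalg_scale (a * b) U.
Proof. by apply/ffunP => A; rewrite !clalg_scaleE mulrA. Qed.
Fact clalg_scale1 : left_id 1 (@clalg_scale R p q).
Proof. by move=> U; apply/ffunP => A; rewrite !clalg_scaleE mul1r. Qed.
Fact clalg_scaleDr : right_distributive (@clalg_scale R p q) +%R.
Proof.
by move=> c U V; apply/ffunP => A; rewrite !(clalg_scaleE, clalgDE) mulrDr.
Qed.
Fact clalg_scaleDl U : {morph (@clalg_scale R p q)^~ U : a b / a + b}.
Proof.
by move=> a b; apply/ffunP => A; rewrite clalgDE !clalg_scaleE mulrDl.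
Qed.

HB.instance Definition _ := GRing.Zmodule_isLmodule.Build R[i] clalg
  clalg_scaleA clalg_scale1 clalg_scaleDr clalg_scaleDl.

Lemma clalgZE c U A : (c *: U) A = c * U A. Proof. exact: clalg_scaleE. Qed.

Lemma clalg_sumE I (r : seq I) (P : pred I) (F : I -> clalg) A :
  (\sum_(i <- r | P i) F i) A = \sum_(i <- r | P i) F i A.
Proof.
by elim/big_rec2: _ => [|i x y _ <-]; rewrite ?clalg0E ?clalgDE.
Qed.

Fact cl1mul : left_id (clalg_one R p q) (@clalg_mul R p q).
Proof.
move=> U; apply/ffunP => D; rewrite clalg_mul.unlock clalg_one.unlock.
rewrite clmulE (bigD1 finset.set0) //= big1.
  by rewrite ffunE eqxx mul1r clsign0l mulr1 addr0 symdC symd0.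
by move=> A /negbTE A0; rewrite ffunE A0 !mul0r.
Qed.

Fact clmul1 : right_id (clalg_one R p q) (@clalg_mul R p q).
Proof.
move=> U; apply/ffunP => D; rewrite clalg_mul.unlock clalg_one.unlock.
rewrite clmulE (bigD1 D) //= big1.
  by rewrite symdd ffunE eqxx mulr1 clsign0r mulr1 addr0.
by move=> A /negbTE AD; rewrite ffunE symd_eq0 AD mulr0 mul0r.
Qed.

Fact clmulDl : left_distributive (@clalg_mul R p q) +%R.
Proof.
move=> U V W; apply/ffunP => D; rewrite clalg_mul.unlock clalgDE.
rewrite !clmulE -big_split /=.
by apply: eq_bigr => A _; rewrite clalgDE !mulrDl.
Qed.

Fact clmulDr : right_distributive (@clalg_mul R p q) +%R.
Proof.
move=> U V W; apply/ffunP => D; rewrite clalg_mul.unlock clalgDE.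
rewrite !clmulE -big_split /=.
by apply: eq_bigr => A _; rewrite clalgDE !(mulrDr, mulrDl).
Qed.

Fact clalg_mulA : associative (@clalg_mul R p q).
Proof. by rewrite clalg_mul.unlock; exact: clmulA. Qed.

Fact clone_neq0 : clalg_one R p q != 0.
Proof.
apply/eqP => /ffunP/(_ finset.set0)/eqP.
by rewrite clalg_one.unlock ffunE clalg0E eqxx oner_eq0.
Qed.

HB.instance Definition _ := GRing.Zmodule_isNzRing.Build clalg
  clalg_mulA cl1mul clmul1 clmulDl clmulDr clone_neq0.

Lemma clalgME U V : U * V = clmul U V.
Proof. by rewrite /GRing.mul /= clalg_mul.unlock. Qed.

Lemma clalg_oneE : 1 = clone R p q :> clalg.
Proof. by rewrite /GRing.one /= clalg_one.unlock. Qed.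

Fact clscaleAl c U V : c *: (U * V) = (c *: U) * V.
Proof.
apply/ffunP => D; rewrite clalgZE !clalgME !clmulE mulr_sumr.
by apply: eq_bigr => A _; rewrite clalgZE !mulrA.
Qed.

HB.instance Definition _ := GRing.Lmodule_isLalgebra.Build _ clalg clscaleAl.

Fact clscaleAr c U V : c *: (U * V) = U * (c *: V).
Proof.
apply/ffunP => D; rewrite clalgZE !clalgME !clmulE mulr_sumr.
by apply: eq_bigr => A _; rewrite clalgZE !mulrA [c * _]mulrC.
Qed.

HB.instance Definition _ := GRing.Lalgebra_isAlgebra.Build _ clalg clscaleAr.

End CliffordAlgebra.

(** * Trace property and center *)

Section Commutant.
Variables (R : realType) (p q : nat).
Local Notation n := (p + q)%N.
Local Notation clsign := (@clsign R p q).
Local Notation clalg := (clalg R p q).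
Implicit Types (A B D : {set 'I_n}) (U V W : clalg).

Lemma clalg_mulE U V D :
  (U * V) D = \sum_A U A * V (symd A D) * clsign A (symd A D).
Proof. by rewrite clalgME clmulE. Qed.

Lemma clalg1E D : (1 : clalg) D = (D == finset.set0)%:R.
Proof. by rewrite clalg_oneE ffunE. Qed.

Lemma clalg_basis_sum U : U = \sum_B U B *: (clbasis R B : clalg).
Proof.
apply/ffunP => D; rewrite clalg_sumE (bigD1 D) //= big1 ?addr0.
  by rewrite clalgZE ffunE eqxx mulr1.
by move=> B BD; rewrite clalgZE ffunE eq_sym (negbTE BD) mulr0.
Qed.

(** The coefficient of a central e_D behaves like a trace: by bimultiplicativity the pairs (A,
    [symd A D]) and ([symd A D], A) carry the same sign as soon as [clsign A D] is symmetric. *)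
Lemma clalg_mulC_center D U V :
  D = finset.set0 \/ (odd n /\ D = finset.setT) -> (U * V) D = (V * U) D.
Proof.
move=> /(clsign_symC R) signDC; rewrite !clalg_mulE.
have symDK : involutive (fun A => symd A D).
  by move=> A; rewrite symdC [symd A D]symdC symdK.
rewrite [RHS](reindex_inj (can_inj symDK)); apply: eq_bigr => A _ /=.
rewrite symDK clsign_symdr clsign_symdl signDC.
by rewrite [V _ * _]mulrC.
Qed.

Lemma in_ClS_comm U V : in_ClS (U * V - V * U : clalg).
Proof.
split=> [|oddn]; rewrite clalgDE clalgNE clalg_mulC_center ?subrr //.
  by left.
by right.
Qed.

Lemma in_ClS_center_eq0 U : (forall V, V * U = U * V) -> in_ClS U -> U = 0.
Proof.
move=> UC [U0 UT]; apply/ffunP => D; rewrite clalg0E.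
apply/eqP/negPn/negP => UD.
suff /even_all_setD1[D0|[oddn DT]] : forall a, ~~ odd #|D :\ a|.
- by move: UD; rewrite D0 U0 eqxx.
- by move: UD; rewrite DT UT ?eqxx //; move: oddn; rewrite card_ord.
(* At this index e^a U and U e^a each have a single term, both built from [U D]; since [U D] is
   nonzero, their equality forces the commutation sign of e^a and e_D to be 1. *)
move=> a; have /ffunP/(_ (symd [set a] D)) := UC (clbasis R [set a]).
rewrite !clalg_mulE (bigD1 [set a]) //= [in RHS](bigD1 D) //= !big1;
  last 2 first.
- move=> A AD; rewrite [clbasis _ _ _]ffunE; case: eqP => [E|]; last first.
    by rewrite mulr0 mul0r.
  case/eqP: AD; apply/eqP; rewrite -symd_eq0; apply/eqP.
  by apply: (can_inj (symdK [set a])); rewrite symdCA E symd0.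
- by move=> A /negbTE Aa; rewrite [clbasis _ _ _]ffunE Aa !mul0r.
rewrite symdK [symd D _]symdC -symdA.
rewrite symdd symd0 [clbasis _ _ _]ffunE eqxx mul1r mulr1 !addr0 clsign1C.
move=> /(mulfI UD); rewrite -[RHS]mul1r => /(mulIf _) sgn1.
have {}sgn1 : (-1) ^+ #|D :\ a| = 1 :> R[i].
  apply: sgn1; have : clsign D [set a] ^+ 2 != 0 by rewrite clsign_sqr oner_eq0.
  by rewrite sqrf_eq0.
apply/negP => oddk; move/eqP: sgn1.
by rewrite -signr_odd oddk expr1 -subr_eq0 -opprD oppr_eq0 -mulr2n pnatr_eq0.
Qed.

End Commutant.

(** * Products of anticommuting elements as a basis *)

Section CliffordSystem.
Variables (R : realType) (p q : nat).
Local Notation n := (p + q)%N.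
Local Notation clalg := (clalg R p q).
Local Notation eta := (@Defs.eta R p q).
Implicit Types (A B D : {set 'I_n}) (U V W : clalg).
Variable h : 'I_n -> clalg.
Hypothesis h_anticomm :
  forall a b, h a * h b + h b * h a = (2%:R * eta a b) *: 1.
Hypothesis Tr_prod : (\prod_a h a) finset.set0 = 0.

Lemma h_sqr a : h a * h a = eta a a *: 1.
Proof.
have := h_anticomm a a; rewrite -mulr2n -scaler_nat -scalerA.
by apply: scalerI; rewrite pnatr_eq0.
Qed.

Lemma h_swap a b : a != b -> h a * h b = - (h b * h a).
Proof.
move=> ab; apply/eqP; rewrite -addr_eq0 h_anticomm eta_eq0 //.
by rewrite mulr0 scale0r.
Qed.

Definition hset A : clalg := \prod_(a in A) h a.

(** The factor [h a] travels to its slot, with a sign for each factor passed, and is there inserted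
    or cancelled against [h a]. Recording [c ^+ 2 = 1] suffices, since only the nonvanishing of c
    matters later. *)
Lemma h_mul_prod (s : seq 'I_n) a A : uniq s -> a \in s ->
  exists2 c : R[i], c ^+ 2 = 1 & h a * \prod_(i <- s | i \in A) h i =
    c *: \prod_(i <- s | i \in symd [set a] A) h i.
Proof.
elim: s => //= x s IHs /andP[xs us]; rewrite inE => /predU1P[->|as_].
  have eqs : \prod_(i <- s | i \in symd [set x] A) h i =
             \prod_(i <- s | i \in A) h i.
    rewrite big_seq_cond [RHS]big_seq_cond; apply: eq_bigl => i.
    rewrite in_symd inE; case: eqVneq => [->|]; last by rewrite addFb.
    by rewrite (negbTE xs).
  rewrite !big_cons in_symd inE eqxx eqs /=; case: (x \in A) => /=.
    by exists (eta x x); rewrite ?eta_sqr // mulrA h_sqr -scalerAl mul1r.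
  by exists 1; rewrite ?expr1n ?scale1r.
have ax : x == a = false by apply: contraNF xs => /eqP->.
have [c c2 IH] := IHs us as_; rewrite !big_cons in_symd inE ax addFb.
case: ifP => _; last by exists c.
exists (- c); rewrite ?sqrrN // mulrA h_swap 1?eq_sym ?ax //.
by rewrite mulNr -mulrA IH scaleNr scalerAr.
Qed.

Lemma hset_mul A B : exists2 c : R[i], c ^+ 2 = 1 &
  hset A * hset B = c *: hset (symd A B).
Proof.
(* The factors of [hset A] are absorbed one at a time, so the induction runs over the part of A
   listed in s. *)
suff gen s : uniq s -> exists2 c : R[i], c ^+ 2 = 1 &
    \prod_(i <- s | i \in A) h i * hset B =
    c *: hset (symd [set i in s | i \in A] B).
  have [c c2 E] := gen _ (index_enum_uniq 'I_n); exists c => //.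
  rewrite /hset E; congr (_ *: hset (symd _ _)).
  by apply/setP => i; rewrite inE mem_index_enum.
elim: s => [_|x s IHs /= /andP[xs /IHs[c c2 E]]].
  exists 1; rewrite ?expr1n // scale1r big_nil mul1r; congr hset.
  by apply/setP => i; rewrite in_symd !inE.
rewrite big_cons; case: ifPn => xA; last first.
  exists c => //; rewrite E; congr (_ *: hset (symd _ _)).
  apply/setP => i; rewrite !inE; case: eqVneq => [->|//].
  by rewrite (negbTE xA) !andbF.
have [d d2 F] := h_mul_prod (symd [set i in s | i \in A] B)
  (index_enum_uniq 'I_n) (mem_index_enum x).
exists (c * d); first by rewrite exprMn c2 d2 mulr1.
rewrite -mulrA E -scalerAr F scalerA symdA; congr (_ *: hset (symd _ _)).
apply/setP => i; rewrite in_symd !inE; case: eqVneq => [->|//].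
by rewrite (negbTE xs) xA.
Qed.

Lemma h_hset_comm a D : h a * hset D = (-1) ^+ #|D :\ a| *: (hset D * h a).
Proof.
rewrite -sum1_card /hset; elim: (index_enum _) => [|x s IHs].
  by rewrite !big_nil mulr1 mul1r scale1r.
rewrite !big_cons !inE; case: (x \in D); rewrite ?andbF //.
case: eqVneq => [->|xa] /=.
  by rewrite -mulrA IHs -scalerAr.
rewrite mulrA h_swap 1?eq_sym // mulNr -!mulrA IHs -scalerAr add1n exprS.
by rewrite mulN1r scaleNr.
Qed.

(** If some [h a] anticommutes with [hset D], moving it cyclically under the trace of
    [hset D * h a * h a] shows that the trace of [hset D] equals its own negative. Otherwise D is
    the full set and the condition on h^1...h^n applies. *)
Lemma Tr_hset D : D != finset.set0 -> hset D finset.set0 = 0.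
Proof.
move=> D0; have [[a odda]|/forallNP all_even] :=
    pselect (exists a, odd #|D :\ a|).
  have E : eta a a * hset D finset.set0 = - (eta a a * hset D finset.set0).
    have E1 : hset D * h a * h a = eta a a *: hset D.
      by rewrite -mulrA h_sqr -scalerAr mulr1.
    have := clalg_mulC_center (h a) (hset D * h a)
      (or_introl erefl : finset.set0 = finset.set0 \/ _).
    rewrite mulrA h_hset_comm -signr_odd odda expr1 scaleN1r mulNr E1.
    by rewrite clalgNE clalgZE => ->.
  have : (2 * eta a a) * hset D finset.set0 = 0.
    by rewrite mulr_natl mulrnAl mulr2n {1}E addNr.
  move/eqP; rewrite !mulf_eq0 pnatr_eq0 /= => /orP[/eqP eta0|/eqP//].
  by have /eqP := eta_sqr R a; rewrite eta0 expr0n eq_sym oner_eq0.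
have /even_all_setD1[D_0|[_ ->]] : forall a, ~~ odd #|D :\ a|.
- by move=> a; apply/negP.
- by rewrite D_0 eqxx in D0.
by rewrite -[RHS]Tr_prod /hset; under eq_bigl do rewrite inE.
Qed.

(* The Gram matrix of the [hset A] for the trace form is diagonal and
   invertible, so these [2 ^ n] elements form a basis. *)
Lemma clbasis_hset B : exists c : {set 'I_n} -> R[i],
  (clbasis R B : clalg) = \sum_D c D *: hset D.
Proof.
pose N := #|{set 'I_n}|.
pose k D := (hset D * hset D) finset.set0.
have k_neq0 D : k D != 0.
  have [c c2] := hset_mul D D; rewrite /k => ->; rewrite clalgZE.
  rewrite symdd /hset big_set0 clalg1E eqxx mulr1.
  by apply: contra_eq_neq c2 => ->; rewrite expr0n eq_sym oner_eq0.
pose M : 'M[R[i]]_N := \matrix_(i, j) hset (enum_val i) (enum_val j).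
(* Since Tr(U V) is the sum over A of [U A * V A * clsign A A], the product of M and M' is the Gram
   matrix with each column divided by its diagonal entry [k]. *)
pose M' : 'M[R[i]]_N := \matrix_(j, l) ((k (enum_val l))^-1 *
  (hset (enum_val l) (enum_val j) * clsign R (enum_val j) (enum_val j))).
have MM' : M *m M' = 1%:M.
  apply/matrixP => i l; rewrite !mxE.
  transitivity ((k (enum_val l))^-1 *
      (hset (enum_val i) * hset (enum_val l)) finset.set0).
    rewrite clalg_mulE mulr_sumr.
    rewrite [RHS](reindex_onto enum_val enum_rank) /=; last first.
      by move=> A _; rewrite enum_rankK.
    apply: eq_big => [j|j _]; first by rewrite enum_valK eqxx.
    by rewrite !mxE symd0 mulrCA !mulrA.
  case: eqVneq => [->|il].
    by rewrite mulVf.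
  have [c _ ->] := hset_mul (enum_val i) (enum_val l).
  rewrite clalgZE Tr_hset ?mulr0 // symd_eq0.
  by apply: contraNneq il => /enum_val_inj->.
exists (fun D => M' (enum_rank B) (enum_rank D)).
apply/ffunP => A; rewrite clalg_sumE.
(* The matrices being square, M' is also a left inverse; its rows are the coordinates of the e_B in
   the family [hset]. *)
have /matrixP/(_ (enum_rank B) (enum_rank A)) := mulmx1C MM'.
rewrite !mxE (inj_eq enum_rank_inj) ffunE eq_sym => <-.
rewrite [RHS](reindex_onto enum_val enum_rank) /=; last first.
  by move=> D _; rewrite enum_rankK.
apply: eq_big => [j|j _]; first by rewrite enum_valK eqxx.
by rewrite clalgZE enum_valK [M _ _]mxE enum_rankK.
Qed.

Lemma in_ClS_commutant_eq0 U :
  (forall a, h a * U = U * h a) -> in_ClS U -> U = 0.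
Proof.
move=> hU; apply: in_ClS_center_eq0 => V.
have hsetU D : hset D * U = U * hset D.
  by rewrite /hset; elim/big_ind: _ => [|x y|a _]; 
    rewrite ?mul1r ?mulr1 // => xU yU; rewrite -mulrA yU !mulrA xU.
have eU B : (clbasis R B : clalg) * U = U * clbasis R B.
  have [c ->] := clbasis_hset B; rewrite mulr_suml mulr_sumr.
  by apply: eq_bigr => D _; rewrite -scalerAl -scalerAr hsetU.
rewrite (clalg_basis_sum V) mulr_suml mulr_sumr.
by apply: eq_bigr => D _; rewrite -scalerAl -scalerAr eU.
Qed.

End CliffordSystem.

(** * Symmetry of mixed second derivatives *)

Section MixedDerivatives.
Variables (R : realType) (V : normedModType R).
Implicit Types (f : V -> R) (u v x : V).

Lemma is_derive_line f u x (s : R) : derivable f (s *: u + x) u ->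
  is_derive s 1 (fun r : R => f (r *: u + x)) ('D_u f (s *: u + x)).
Proof.
have E : (fun r : R => r^-1 *: (f ((r *: 1 + s) *: u + x) - f (s *: u + x))) =
         (fun r : R => r^-1 *: (f (r *: u + (s *: u + x)) - f (s *: u + x))).
  by apply/funext => r; rewrite [r *: 1]mulr1 scalerDl addrA.
move=> df; split; first by move: df; rewrite /derivable /= E.
by rewrite /derive /= E.
Qed.

Lemma MVT_line f u x (t : R) : 0 < t -> (forall y, derivable f y u) ->
  exists2 s, 0 < s < t & f (t *: u + x) - f x = t * 'D_u f (s *: u + x).
Proof.
move=> t0 df; pose g (r : R) := f (r *: u + x).
have dg (s : R) : is_derive s 1 g ('D_u f (s *: u + x)).
  exact: is_derive_line.
have cg : {within `[0, t], continuous g}%classic.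
  by apply: derivable_within_continuous => s _; have [] := dg s.
have [c c0t] := MVT t0 (fun s _ => dg s) cg.
rewrite /g scale0r add0r subr0 mulrC => E.
by exists c.
Qed.

(** Two mean value steps: along u for the increment g of f in direction v, then along v for the
    derivative of f in direction u. *)
Lemma MVT_square f u v x (t : R) : 0 < t ->
  (forall y, derivable f y u) -> (forall y, derivable ('D_u f) y v) ->
  exists s r, [/\ 0 < s < t, 0 < r < t &
    f (t *: u + (t *: v + x)) - f (t *: u + x) - (f (t *: v + x) - f x) =
    t * (t * 'D_v ('D_u f) (r *: v + (s *: u + x)))].
Proof.
move=> t0 df ddf; pose g y := f (t *: v + y) - f y.
have dshift y : is_derive y u (fun z => f (t *: v + z)) ('D_u f (t *: v + y)).
  have E : (fun r : R => r^-1 *: (f (t *: v + (r *: u + y)) - f (t *: v + y))) =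
           (fun r : R => r^-1 *: (f (r *: u + (t *: v + y)) - f (t *: v + y))).
    by apply/funext => r; rewrite addrCA.
  have dfy := df (t *: v + y); split.
    by move: dfy; rewrite /derivable /= E.
  by rewrite /derive /= E.
have dg y : is_derive y u g ('D_u f (t *: v + y) - 'D_u f y).
  have dfy := derivableP (df y).
  exact: (is_deriveB (dshift y) dfy).
have [|s s0t] := @MVT_line g u x t t0; first by move=> y; have [] := dg y.
rewrite /g (derive_val (is_derive := dg _)) => Eg.
have [r r0t Er] := MVT_line (s *: u + x) t0 ddf.
exists s, r; split=> //; rewrite -Er -Eg [t *: u + (_ + _)]addrCA.
by rewrite !addrA.
Qed.

(** The second difference of f is symmetric in u and v, so the two mixed derivatives agree at some
    pair of points near x; continuity at x bounds their difference at x by any e > 0. *)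
Lemma derive_comm f u v x :
  (forall y, derivable f y u) -> (forall y, derivable f y v) ->
  (forall y, derivable ('D_u f) y v) -> (forall y, derivable ('D_v f) y u) ->
  {for x, continuous ('D_v ('D_u f))} -> {for x, continuous ('D_u ('D_v f))} ->
  'D_v ('D_u f) x = 'D_u ('D_v f) x.
Proof.
move=> fu fv fuv fvu cuv cvu; apply/eqP; rewrite -subr_eq0 -normr_le0.
apply/ler_addgt0Pr => e e0; rewrite add0r.
have e20 : 0 < e / 2 by rewrite divr_gt0.
have /cvgrPdist_le/(_ _ e20)/nbhs_ballP[d1 /= d10 near1] := cuv.
have /cvgrPdist_le/(_ _ e20)/nbhs_ballP[d2 /= d20 near2] := cvu.
(* The summand 1 keeps K positive when u = v = 0 and makes the distance estimate below strict. *)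
pose K := `|u| + `|v| + 1; have K0 : 0 < K by rewrite ltr_wpDl ?addr_ge0.
pose t := Num.min d1 d2 / K; have t0 : 0 < t by rewrite divr_gt0 // lt_min d10.
have close a b s r : `|a| + `|b| < K -> 0 < s < t -> 0 < r < t ->
    `|r *: b + (s *: a + x) - x| < Num.min d1 d2.
  move=> abK /andP[s0 st] /andP[r0 rt]; rewrite addrA addrK.
  have -> : Num.min d1 d2 = t * K by rewrite divfK ?gt_eqF.
  apply: (le_lt_trans (ler_normD _ _)); rewrite !normrZ !gtr0_norm //.
  apply: le_lt_trans (_ : t * (`|a| + `|b|) < _); last by rewrite ltr_pM2l.
  by rewrite mulrDr addrC lerD // ler_wpM2r // ltW.
have uvK : `|u| + `|v| < K by rewrite ltrDl.
have vuK : `|v| + `|u| < K by rewrite addrC.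
have [s1 [r1 [s1t r1t E1]]] := MVT_square x t0 fu fuv.
have [s2 [r2 [s2t r2t E2]]] := MVT_square x t0 fv fvu.
set y := r1 *: v + (s1 *: u + x) in E1; set z := r2 *: u + (s2 *: v + x) in E2.
have Eyz : 'D_v ('D_u f) y = 'D_u ('D_v f) z.
  apply: (mulfI (lt0r_neq0 t0)); apply: (mulfI (lt0r_neq0 t0)).
  rewrite -E1 -E2 [t *: v + (_ + _)]addrCA !opprB; ring.
have y1 : `|'D_v ('D_u f) x - 'D_v ('D_u f) y| <= e / 2.
  apply: near1; rewrite -ball_normE /= distrC.
  by have := close _ _ _ _ uvK s1t r1t; rewrite lt_min => /andP[].
have z2 : `|'D_u ('D_v f) x - 'D_u ('D_v f) z| <= e / 2.
  apply: near2; rewrite -ball_normE /= distrC.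
  by have := close _ _ _ _ vuK s2t r2t; rewrite lt_min => /andP[].
rewrite [e]splitr; apply: le_trans (lerD y1 z2).
rewrite -Eyz [leRHS](congr1 (fun c => _ + c) (distrC _ _)); exact: ler_distD.
Qed.

End MixedDerivatives.

(** * Derivatives of complex-valued functions *)

Section ComplexDerivative.
Variables (R : realType) (V : normedModType R).
Implicit Types (f g : V -> R[i]) (x v : V) (c df dg : R[i]).

Definition is_cderive x v f df :=
  is_derive x v (fun y => complex.Re (f y)) (complex.Re df) /\
  is_derive x v (fun y => complex.Im (f y)) (complex.Im df).

Definition cderivable f x v := exists df, is_cderive x v f df.

Lemma ReD c d : complex.Re (c + d) = complex.Re c + complex.Re d.
Proof. by case: c; case: d. Qed.
Lemma ImD c d : complex.Im (c + d) = complex.Im c + complex.Im d.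
Proof. by case: c; case: d. Qed.
Lemma ReM c d : complex.Re (c * d) =
  complex.Re c * complex.Re d - complex.Im c * complex.Im d.
Proof. by case: c; case: d. Qed.
Lemma ImM c d : complex.Im (c * d) =
  complex.Re c * complex.Im d + complex.Im c * complex.Re d.
Proof. by case: c; case: d. Qed.

Lemma is_cderive_cst x v c : is_cderive x v (fun=> c) 0.
Proof. by split; exact: is_derive_cst. Qed.

Lemma is_cderiveD x v f g df dg : is_cderive x v f df -> is_cderive x v g dg ->
  is_cderive x v (fun y => f y + g y) (df + dg).
Proof.
move=> [fr fi] [gr gi]; split.
- rewrite ReD (_ : (fun _ => _) = (fun y => complex.Re (f y)) +
      (fun y => complex.Re (g y))); first exact: is_deriveD.
  by apply/funext => y; rewrite ReD.
- rewrite ImD (_ : (fun _ => _) = (fun y => complex.Im (f y)) +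
      (fun y => complex.Im (g y))); first exact: is_deriveD.
  by apply/funext => y; rewrite ImD.
Qed.

Lemma is_cderiveM x v f g df dg : is_cderive x v f df -> is_cderive x v g dg ->
  is_cderive x v (fun y => f y * g y) (df * g x + f x * dg).
Proof.
move=> [fr fi] [gr gi]; split.
- rewrite (_ : (fun _ => _) =
      (fun y => complex.Re (f y)) * (fun y => complex.Re (g y)) -
      (fun y => complex.Im (f y)) * (fun y => complex.Im (g y))); last first.
    by apply/funext => y; rewrite ReM.
  apply: is_derive_eq (is_deriveB (is_deriveM fr gr) (is_deriveM fi gi)) _.
  by rewrite ReD !ReM /GRing.scale /=; ring.
- rewrite (_ : (fun _ => _) =
      (fun y => complex.Re (f y)) * (fun y => complex.Im (g y)) +
      (fun y => complex.Im (f y)) * (fun y => complex.Re (g y))); last first.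
    by apply/funext => y; rewrite ImM.
  apply: is_derive_eq (is_deriveD (is_deriveM fr gi) (is_deriveM fi gr)) _.
  by rewrite ImD !ImM /GRing.scale /=; ring.
Qed.

Lemma is_cderive_unique x v f df dg :
  is_cderive x v f df -> is_cderive x v f dg -> df = dg.
Proof.
move=> [fr fi] [gr gi]; apply/eqP; rewrite eq_complex.
rewrite -(derive_val (is_derive := fr)) -(derive_val (is_derive := gr)).
rewrite -(derive_val (is_derive := fi)) -(derive_val (is_derive := gi)).
by rewrite !eqxx.
Qed.

Lemma is_cderive_sum x v I (r : seq I) (P : pred I) (F : I -> V -> R[i])
    (dF : I -> R[i]) : (forall i, is_cderive x v (F i) (dF i)) ->
  is_cderive x v (fun y => \sum_(i <- r | P i) F i y)
    (\sum_(i <- r | P i) dF i).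
Proof.
move=> FD; rewrite (_ : (fun _ => _) = \sum_(i <- r | P i) F i); last first.
  by apply/funext => y; rewrite fct_sumE.
elim/big_ind2: _ => [|F1 dF1 F2 dF2 FD1 FD2|//].
  exact: is_cderive_cst.
exact: is_cderiveD.
Qed.

Lemma cderivable_sum I (r : seq I) (P : pred I) (F : I -> V -> R[i]) x v :
  (forall i, cderivable (F i) x v) ->
  cderivable (fun y => \sum_(i <- r | P i) F i y) x v.
Proof.
move=> dF; rewrite (_ : (fun _ => _) = \sum_(i <- r | P i) F i); last first.
  by apply/funext => y; rewrite fct_sumE.
elim/big_ind: _ => [|f g [df fD] [dg gD]|//].
  by exists 0; exact: is_cderive_cst.
by exists (df + dg); exact: is_cderiveD.
Qed.

Lemma cderivableM f g x v :
  cderivable f x v -> cderivable g x v -> cderivable (fun y => f y * g y) x v.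
Proof.
by move=> [df fD] [dg gD]; exists (df * g x + f x * dg); exact: is_cderiveM.
Qed.

Lemma cderivable_cst c x v : cderivable (fun=> c) x v.
Proof. by exists 0; exact: is_cderive_cst. Qed.

Lemma cderivable_prod I (r : seq I) (P : pred I) (F : I -> V -> R[i]) x v :
  (forall i, cderivable (F i) x v) ->
  cderivable (fun y => \prod_(i <- r | P i) F i y) x v.
Proof.
move=> dF; rewrite (_ : (fun _ => _) = \prod_(i <- r | P i) F i); last first.
  by apply/funext => y; rewrite fct_prodE.
elim/big_ind: _ => [|f g fD gD|//]; first exact: cderivable_cst.
exact: cderivableM.
Qed.

(** The inverse is the conjugate divided by N = |f|^2, and N is nonzero at x. *)
Lemma cderivableV f x v : f x != 0 -> cderivable f x v ->
  cderivable (fun y => (f y)^-1) x v.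
Proof.
move=> fx0 [df [fr fi]].
pose N y := complex.Re (f y) ^+ 2 + complex.Im (f y) ^+ 2.
have N0 : N x != 0.
  rewrite /N paddr_eq0 ?sqr_ge0 // !sqrf_eq0.
  by move: fx0; rewrite eq_complex.
have drf := ex_derive (is_derive := fr).
have dif := ex_derive (is_derive := fi).
have dN : derivable N x v.
  exact: (derivableD (@derivableX _ _ _ 2 _ _ drf)
    (@derivableX _ _ _ 2 _ _ dif)).
have dNV : derivable (fun y => (N y)^-1) x v by exact: derivableV.
have rD : derivable (fun y => complex.Re (f y)^-1) x v.
  rewrite (_ : (fun _ => _) =
      (fun y => complex.Re (f y)) * (fun y => (N y)^-1)).
    exact: (derivableM drf dNV).
  by apply/funext => y; rewrite /N !fctE /=; case: (f y).
have iD : derivable (fun y => complex.Im (f y)^-1) x v.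
  rewrite (_ : (fun _ => _) =
      (- (fun y => complex.Im (f y))) * (fun y => (N y)^-1)).
    exact: (derivableM (derivableN dif) dNV).
  apply/funext => y; rewrite /N !fctE /=.
  by case: (f y) => a b /=; rewrite mulNr.
exists (Complex ('D_v (fun y => complex.Re (f y)^-1) x)
                ('D_v (fun y => complex.Im (f y)^-1) x)).
by split; [exact: (derivableP rD) | exact: (derivableP iD)].
Qed.

Lemma cderivable_det m (F : V -> 'M[R[i]]_m) x v :
  (forall i j, cderivable (fun y => F y i j) x v) ->
  cderivable (fun y => \det (F y)) x v.
Proof.
move=> dF; apply: cderivable_sum => s; apply: cderivableM.
  exact: cderivable_cst.
by apply: cderivable_prod => i; exact: dF.
Qed.

Lemma cderivable_invmx m (F : V -> 'M[R[i]]_m) x v :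
  (forall y, F y \in unitmx) ->
  (forall i j, cderivable (fun y => F y i j) x v) ->
  forall i j, cderivable (fun y => invmx (F y) i j) x v.
Proof.
move=> uF dF i j; rewrite (_ : (fun _ => _) =
  (fun y => (\det (F y))^-1 * cofactor (F y) j i)); last first.
  by apply/funext => y; rewrite /invmx uF !mxE.
apply: cderivableM; last first.
  apply: cderivableM; first exact: cderivable_cst.
  apply: cderivable_det => k l.
  rewrite (_ : (fun _ => _) = (fun y => F y (lift j k) (lift i l))) //.
  by apply/funext => y; rewrite !mxE.
apply: cderivableV (cderivable_det dF).
by rewrite -unitfE; have := uF x; rewrite unitmxE.
Qed.

End ComplexDerivative.

(** * Derivatives of Clifford-valued functions *)

Definition clpd (R : realType) (p q : nat) (mu : 'I_(p + q))
  (F : 'rV[R]_(p + q) -> clalg R p q) : 'rV[R]_(p + q) -> clalg R p q :=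
  pd mu F.

Section CliffordDerivative.
Variables (R : realType) (p q : nat).
Local Notation n := (p + q)%N.
Local Notation clalg := (clalg R p q).
Local Notation V := 'rV[R]_n.
Local Notation pd := (@clpd R p q).
Implicit Types (F G : V -> clalg) (x : V) (dF dG : clalg) (mu nu : 'I_n).

(** Unlike the total function [pd], this relation asserts that every coefficient is differentiable,
    as the product rule requires. *)
Definition is_clderive x mu F dF :=
  forall A, is_cderive x (ev R mu) (fun y => F y A) (dF A).

Lemma is_clderive_unique x mu F dF dG :
  is_clderive x mu F dF -> is_clderive x mu F dG -> dF = dG.
Proof.
by move=> FF FG; apply/ffunP => A; apply: is_cderive_unique (FF A) (FG A).
Qed.

Lemma is_clderive_pd x mu F dF : is_clderive x mu F dF -> pd mu F x = dF.
Proof.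
move=> FF; apply/ffunP => A; rewrite ffunE; have [fr fi] := FF A.
rewrite /rpd (derive_val (is_derive := fr)) (derive_val (is_derive := fi)).
by case: (dF A).
Qed.

Lemma is_clderive_cst x mu dF : is_clderive x mu (fun=> dF) 0.
Proof. by move=> A; rewrite clalg0E; exact: is_cderive_cst. Qed.

Lemma is_clderiveD x mu F G dF dG :
  is_clderive x mu F dF -> is_clderive x mu G dG ->
  is_clderive x mu (fun y => F y + G y) (dF + dG).
Proof.
move=> FD GD A; rewrite clalgDE (_ : (fun _ => _) = fun y => F y A + G y A).
  exact: is_cderiveD.
by apply/funext => y; rewrite clalgDE.
Qed.

Lemma is_clderiveZ x mu (c : R[i]) F dF :
  is_clderive x mu F dF -> is_clderive x mu (fun y => c *: F y) (c *: dF).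
Proof.
move=> FD A; rewrite clalgZE (_ : (fun _ => _) = fun y => c * F y A).
  have := is_cderiveM (is_cderive_cst x (ev R mu) c) (FD A).
  by rewrite mul0r add0r.
by apply/funext => y; rewrite clalgZE.
Qed.

Lemma is_clderiveB x mu F G dF dG :
  is_clderive x mu F dF -> is_clderive x mu G dG ->
  is_clderive x mu (fun y => F y - G y) (dF - dG).
Proof.
move=> FD GD; rewrite -scaleN1r (_ : (fun _ => _) = fun y => F y + (-1) *: G y).
  by apply: is_clderiveD => //; exact: is_clderiveZ.
by apply/funext => y; rewrite scaleN1r.
Qed.

Lemma is_clderiveM x mu F G dF dG :
  is_clderive x mu F dF -> is_clderive x mu G dG ->
  is_clderive x mu (fun y => F y * G y) (dF * G x + F x * dG).
Proof.
move=> FD GD D; rewrite clalgDE !clalg_mulE -big_split /=.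
rewrite (_ : (fun _ => _) = fun y =>
    \sum_A F y A * G y (symd A D) * clsign R A (symd A D)); last first.
  by apply/funext => y; rewrite clalg_mulE.
apply: is_cderive_sum => A; set s := clsign _ _ _.
have := is_cderiveM (is_cderiveM (FD A) (GD (symd A D)))
  (is_cderive_cst x (ev R mu) s).
by rewrite mulr0 addr0 mulrDl.
Qed.

End CliffordDerivative.

(** * Differentiating the inverse; fields of class C^2 *)

Section CliffordInverse.
Variables (R : realType) (p q : nat).
Local Notation n := (p + q)%N.
Local Notation clalg := (clalg R p q).
Local Notation V := 'rV[R]_n.
Local Notation pd := (@clpd R p q).
Implicit Types (F S T : V -> clalg) (x : V) (mu nu : 'I_n).

(* Cramer's rule for the matrices of the right multiplications. *)
Lemma clderivableV x mu S T (dS : clalg) : (forall y, S y * T y = 1) ->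
  is_clderive x mu S dS ->
  forall A, cderivable (fun y => T y A) x (ev R mu).
Proof.
move=> ST SD A; pose N := #|{set 'I_n}|.
pose e B : clalg := clbasis R B.
pose L (U : clalg) : 'M[R[i]]_N :=
  \matrix_(i, j) (e (enum_val i) * U) (enum_val j).
have LM U W : L U *m L W = L (U * W).
  apply/matrixP => i l; rewrite !mxE mulrA.
  rewrite [in RHS](clalg_basis_sum (e (enum_val i) * U)) mulr_suml clalg_sumE.
  rewrite [RHS](reindex_onto enum_val enum_rank) /=; last first.
    by move=> D _; rewrite enum_rankK.
  apply: eq_big => [j|j _]; first by rewrite enum_valK eqxx.
  by rewrite !mxE -scalerAl clalgZE.
have L1 : L 1 = 1%:M.
  apply/matrixP => i j; rewrite !mxE mulr1 ffunE (inj_eq enum_val_inj).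
  by rewrite eq_sym.
have LST y : L (S y) *m L (T y) = 1%:M by rewrite LM ST L1.
have uL y : L (S y) \in unitmx by have [] := mulmx1_unit (LST y).
have LT y : L (T y) = invmx (L (S y)).
  by rewrite -[LHS](mulKmx (uL y)) LST mulmx1.
(* The row of [L (T y)] that belongs to e lists the coefficients of e times [T y], that is, of
   [T y]. *)
rewrite (_ : (fun _ => _) = fun y =>
    invmx (L (S y)) (enum_rank finset.set0) (enum_rank A)); last first.
  apply/funext => y; rewrite -LT mxE !enum_rankK.
  by have -> : e finset.set0 = 1; rewrite ?clalg_oneE // -clalg_oneE mul1r.
apply: cderivable_invmx => // i j.
have := is_clderiveM (is_clderive_cst x mu (e (enum_val i))) SD (enum_val j).
rewrite (_ : (fun _ => _) = fun y => L (S y) i j).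
  by eexists; eassumption.
by apply/funext => y; rewrite mxE.
Qed.

(** Once T is known to be differentiable, differentiate [T y * S y = 1] and multiply by [T x] on the
    right. *)
Lemma is_clderiveV x mu S T (dS : clalg) :
  (forall y, S y * T y = 1) -> (forall y, T y * S y = 1) ->
  is_clderive x mu S dS -> is_clderive x mu T (- (T x * dS * T x)).
Proof.
move=> ST TS SD; have [dT TD] := choice (clderivableV ST SD).
have TD' : is_clderive x mu T ([ffun A => dT A] : clalg).
  by move=> A; rewrite ffunE.
suff <- : ([ffun A => dT A] : clalg) = - (T x * dS * T x) by [].
have := is_clderiveM TD' SD; rewrite (_ : (fun _ => _) = fun=> 1); last first.
  exact/funext.
move=> /is_clderive_unique/(_ (is_clderive_cst _ _ _))/eqP.
rewrite addr_eq0 => /eqP /(congr1 (fun U => U * T x)).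
by rewrite -mulrA ST mulr1 mulNr.
Qed.

Lemma pdE mu F x A : pd mu F x A =
  Complex (rpd mu (fun y => complex.Re (F y A)) x)
          (rpd mu (fun y => complex.Im (F y A)) x).
Proof. exact: ffunE. Qed.

Lemma Re_pd mu F A : (fun y => complex.Re (pd mu F y A)) =
  rpd mu (fun y => complex.Re (F y A)).
Proof. by apply/funext => y; rewrite pdE. Qed.

Lemma Im_pd mu F A : (fun y => complex.Im (pd mu F y A)) =
  rpd mu (fun y => complex.Im (F y A)).
Proof. by apply/funext => y; rewrite pdE. Qed.

Lemma is_clderive_derivable x mu F :
  (forall A, derivable (fun y => complex.Re (F y A)) x (ev R mu) /\
             derivable (fun y => complex.Im (F y A)) x (ev R mu)) ->
  is_clderive x mu F (pd mu F x).
Proof.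
by move=> FD A; have [fr fi] := FD A; rewrite ffunE; split; exact/derivableP.
Qed.

Lemma clC2_is_clderive x mu F : clC2 F -> is_clderive x mu F (pd mu F x).
Proof.
move=> FC; apply: is_clderive_derivable => A.
by have [[_ + _ _ _] [_ + _ _ _]] := FC A.
Qed.

Lemma clC2_is_clderive2 x mu nu F :
  clC2 F -> is_clderive x nu (pd mu F) (pd nu (pd mu F) x).
Proof.
move=> FC; apply: is_clderive_derivable => A.
have [[_ _ _ r2 _] [_ _ _ i2 _]] := FC A; split.
- by rewrite Re_pd; exact: r2.
- by rewrite Im_pd; exact: i2.
Qed.

Lemma rC2_rpd_comm (f : V -> R) mu nu : rC2 f ->
  rpd nu (rpd mu f) = rpd mu (rpd nu f).
Proof.
move=> [_ d1 _ d2 c2]; apply/funext => x.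
exact: (derive_comm (d1 mu) (d1 nu) (d2 mu nu) (d2 nu mu)
  (c2 mu nu x) (c2 nu mu x)).
Qed.

Lemma clC2_pd_comm mu nu F : clC2 F -> pd nu (pd mu F) = pd mu (pd nu F).
Proof.
move=> FC; apply/funext => x; apply/ffunP => A; rewrite [LHS]pdE [RHS]pdE.
have [rC iC] := FC A.
by rewrite !Re_pd !Im_pd (rC2_rpd_comm mu nu rC) (rC2_rpd_comm mu nu iC).
Qed.

Lemma rsmooth_rC2 (f : V -> R) : rsmooth f -> rC2 f.
Proof.
move=> sf; split=> *; [exact: (sf [::]).1 | exact: (sf [::]).2 |
  exact: (sf [:: _]).1 | exact: (sf [:: _]).2 | exact: (sf [:: _; _]).1].
Qed.

Lemma clsmooth_clC2 F : clsmooth F -> clC2 F.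
Proof. by move=> sF A; have [sr si] := sF A; split; exact: rsmooth_rC2. Qed.

End CliffordInverse.

(** * Commutators and gauge transformations *)

Section GaugeTransform.
Variables (R : realType) (p q : nat).
Local Notation n := (p + q)%N.
Local Notation clalg := (clalg R p q).
Local Notation V := 'rV[R]_n.
Implicit Types (x : V) (mu nu : 'I_n).

Definition comm (U W : clalg) : clalg := U * W - W * U.

Definition clconj (T X S : clalg) : clalg := T * X * S.

Lemma clconjB (T X Y S : clalg) :
  clconj T (X - Y) S = clconj T X S - clconj T Y S.
Proof. by rewrite /clconj mulrBr mulrBl. Qed.

Lemma clconjZ c (T X S : clalg) : clconj T (c *: X) S = c *: clconj T X S.
Proof. by rewrite /clconj -scalerAr -scalerAl. Qed.

Lemma clconjD (T X Y S : clalg) :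
  clconj T (X + Y) S = clconj T X S + clconj T Y S.
Proof. by rewrite /clconj mulrDr mulrDl. Qed.

Lemma is_clderive_comm x mu (F G : V -> clalg) (dF dG : clalg) :
  is_clderive x mu F dF -> is_clderive x mu G dG ->
  is_clderive x mu (fun y => comm (F y) (G y)) (comm dF (G x) + comm (F x) dG).
Proof.
move=> FD GD; have := is_clderiveB (is_clderiveM FD GD) (is_clderiveM GD FD).
rewrite /comm; congr is_clderive.
(* [ring] works in the complex coefficients, where the noncommutative products are atoms. *)
by apply/ffunP => A; rewrite !(clalgDE, clalgNE); ring.
Qed.

Lemma comm_jacobi (U W X : clalg) :
  comm U (comm W X) = comm (comm U W) X + comm W (comm U X).
Proof.
rewrite /comm !(mulrBr, mulrBl) !mulrA.
by apply/ffunP => A; rewrite !(clalgDE, clalgNE); ring.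
Qed.

Lemma commDl (U W X : clalg) : comm (U + W) X = comm U X + comm W X.
Proof.
rewrite /comm mulrDl mulrDr.
by apply/ffunP => A; rewrite !(clalgDE, clalgNE); ring.
Qed.

Lemma commC (U W : clalg) : comm U W = - comm W U.
Proof. by rewrite opprB. Qed.

Lemma commDr (U W X : clalg) : comm U (W + X) = comm U W + comm U X.
Proof. by rewrite commC commDl opprD -!commC. Qed.

Lemma commZl c (U W : clalg) : comm (c *: U) W = c *: comm U W.
Proof. by rewrite /comm scalerBr -scalerAl -scalerAr. Qed.

Lemma commZr c (U W : clalg) : comm U (c *: W) = c *: comm U W.
Proof. by rewrite commC commZl -scalerN -commC. Qed.

Section Transform.
Variables S T : V -> clalg.
Hypotheses (ST : forall y, S y * T y = 1) (TS : forall y, T y * S y = 1).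

(** Because d(S^-1) = - S^-1 dS S^-1, the derivatives of the two outer factors combine into a
    commutator with S^-1 dS. *)
Lemma is_clderive_clconj x mu (X : V -> clalg) (dX dS : clalg) :
  is_clderive x mu S dS -> is_clderive x mu X dX ->
  is_clderive x mu (fun y => clconj (T y) (X y) (S y))
    (clconj (T x) dX (S x) + comm (clconj (T x) (X x) (S x)) (T x * dS)).
Proof.
move=> SD XD.
have := is_clderiveM (is_clderiveM (is_clderiveV ST TS SD) XD) SD.
congr is_clderive; rewrite /clconj /comm.
have -> : T x * X x * S x * (T x * dS) = T x * X x * dS.
  by rewrite -!mulrA [S x * _]mulrA ST mul1r.
rewrite !(mulrDl, mulNr) !mulrA.
by apply/ffunP => A; rewrite !(clalgDE, clalgNE); ring.
Qed.

Lemma clconj_comm x (U W : clalg) : clconj (T x) (comm U W) (S x) =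
  comm (clconj (T x) U (S x)) (clconj (T x) W (S x)).
Proof.
rewrite /comm /clconj mulrBr mulrBl; congr (_ - _).
  by rewrite -!mulrA [S x * (T x * _)]mulrA ST mul1r.
by rewrite -!mulrA [S x * (T x * _)]mulrA ST mul1r.
Qed.

(** [Sm] and [Sn] stand for the partial derivatives of S. Both mixed derivatives have the same value
    [ddS], so the second-order terms cancel; the terms quadratic in S^-1 dS cancel against the
    commutator. *)
Lemma curvature_clconj x mu nu (Bm Bn : V -> clalg)
    (Sm Sn : V -> clalg) (dBn dBm ddS : clalg) :
  is_clderive x mu S (Sm x) -> is_clderive x nu S (Sn x) ->
  is_clderive x mu Sn ddS -> is_clderive x nu Sm ddS ->
  is_clderive x mu Bn dBn -> is_clderive x nu Bm dBm ->
  let B' (B Sd : V -> clalg) y := clconj (T y) (B y) (S y) - T y * Sd y in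
  exists dBn' dBm',
    [/\ is_clderive x mu (B' Bn Sn) dBn', is_clderive x nu (B' Bm Sm) dBm' &
    dBn' - dBm' - comm (B' Bm Sm x) (B' Bn Sn x) =
    clconj (T x) (dBn - dBm - comm (Bm x) (Bn x)) (S x)].
Proof.
move=> SmD SnD SnmD SmnD BnD BmD B'.
do 2 eexists; split.
- apply: is_clderiveB; first exact: is_clderive_clconj SmD BnD.
  exact: is_clderiveM (is_clderiveV ST TS SmD) SnmD.
- apply: is_clderiveB; first exact: is_clderive_clconj SnD BmD.
  exact: is_clderiveM (is_clderiveV ST TS SnD) SmnD.
have -> : clconj (T x) (dBn - dBm - comm (Bm x) (Bn x)) (S x) =
    clconj (T x) dBn (S x) - clconj (T x) dBm (S x) -
    comm (clconj (T x) (Bm x) (S x)) (clconj (T x) (Bn x) (S x)).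
  by rewrite 2!clconjB clconj_comm.
rewrite /B'; set bm := clconj _ (Bm x) _; set bn := clconj _ (Bn x) _.
set dm := clconj _ dBm _; set dn := clconj _ dBn _.
rewrite /comm !(mulrBl, mulrBr, mulNr) !mulrA.
by apply/ffunP => A; rewrite !(clalgDE, clalgNE); ring.
Qed.

(** The commutator produced by differentiating the conjugation cancels the one coming from the
    inhomogeneous term - S^-1 dS of the transformed potential. *)
Lemma covderiv_clconj x mu (B G : V -> clalg) (dS dG : clalg) :
  is_clderive x mu S dS -> is_clderive x mu G dG ->
  exists2 dG', is_clderive x mu (fun y => clconj (T y) (G y) (S y)) dG' &
    dG' - comm (clconj (T x) (B x) (S x) - T x * dS)
               (clconj (T x) (G x) (S x)) =
    clconj (T x) (dG - comm (B x) (G x)) (S x).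
Proof.
move=> SD GD; eexists; first exact: is_clderive_clconj SD GD.
rewrite clconjB clconj_comm.
set a := T x * dS; set g := clconj _ (G x) _; set b := clconj _ (B x) _.
rewrite /comm !(mulrBr, mulrBl).
by apply/ffunP => A; rewrite !(clalgDE, clalgNE); ring.
Qed.

End Transform.

End GaugeTransform.

(** * The Yang-Mills equation for a parallel Clifford field vector *)

Section ParallelCliffordField.
Variables (R : realType) (p q : nat).
Local Notation n := (p + q)%N.
Local Notation clalg := (clalg R p q).
Local Notation V := 'rV[R]_n.
Local Notation eta := (@Defs.eta R p q).
Local Notation pd := (@clpd R p q).
Implicit Types (x : V) (mu nu rho : 'I_n).

Lemma in_ClSB (U W : clalg) : in_ClS U -> in_ClS W -> in_ClS (U - W).
Proof.
move=> [U0 UT] [W0 WT]; split=> [|oddn]; rewrite clalgDE clalgNE.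
  by rewrite U0 W0 subr0.
by rewrite UT // WT // subr0.
Qed.

Lemma in_ClS_pd (F : V -> clalg) mu x :
  (forall y, in_ClS (F y)) -> in_ClS (pd mu F x).
Proof.
have pd0 A : (forall y, F y A = 0) -> pd mu F x A = 0.
  move=> F0; rewrite pdE /rpd.
  have -> : (fun y => complex.Re (F y A)) = cst 0.
    by apply/funext => y; rewrite F0.
  have -> : (fun y => complex.Im (F y A)) = cst 0.
    by apply/funext => y; rewrite F0.
  by rewrite derive_cst.
move=> FS; split=> [|oddn]; apply: pd0 => y; have [F0 FT] := FS y => //.
exact: FT.
Qed.

Variables h C : 'I_n -> V -> clalg.
Hypothesis h_anticomm : forall x mu nu,
  h mu x * h nu x + h nu x * h mu x = (2%:R * eta mu nu) *: 1.
Hypothesis Tr_h : forall x, (\prod_mu h mu x) finset.set0 = 0.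
Hypothesis h_C2 : forall mu, clC2 (h mu).
Hypothesis C_ClS : forall mu x, in_ClS (C mu x).
Hypothesis C_C2 : forall mu, clC2 (C mu).
Hypothesis h_parallel : forall mu rho x,
  pd mu (h rho) x = comm (C mu x) (h rho x).

Lemma h_is_clderive mu rho x :
  is_clderive x mu (h rho) (comm (C mu x) (h rho x)).
Proof. by rewrite -h_parallel; exact: clC2_is_clderive. Qed.

Lemma C_is_clderive mu nu x : is_clderive x mu (C nu) (pd mu (C nu) x).
Proof. exact: clC2_is_clderive. Qed.

Lemma connection_flat mu nu x :
  pd mu (C nu) x - pd nu (C mu) x - comm (C mu x) (C nu x) = 0.
Proof.
have dd a b rho : pd a (pd b (h rho)) x =
    comm (pd a (C b) x) (h rho x) + comm (C b x) (comm (C a x) (h rho x)).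
  apply: is_clderive_pd.
  have -> : pd b (h rho) = fun y => comm (C b y) (h rho y).
    by apply/funext => y; exact: h_parallel.
  exact: is_clderive_comm (C_is_clderive _ _ _) (h_is_clderive _ _ _).
apply: (in_ClS_commutant_eq0 (h_anticomm x) (Tr_h x)) => [rho|]; last first.
  exact: (in_ClSB (in_ClSB (in_ClS_pd mu x (C_ClS nu))
    (in_ClS_pd nu x (C_ClS mu))) (in_ClS_comm _ _)).
have := congr1 (@^~ x) (clC2_pd_comm mu nu (h_C2 rho)); rewrite !dd /= => E.
apply/esym/eqP; rewrite -subr_eq0 -/(comm _ _); apply/eqP.
rewrite -[X in comm X _]addrA -opprD commDl.
have commNl U W : comm (- U) W = - comm U W :> clalg.
  by rewrite -scaleN1r commZl scaleN1r.
rewrite commNl commDl.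
(* The two double commutators in E differ by [[C_mu, C_nu], h^rho], the missing quadratic part of
   the curvature. *)
have J := comm_jacobi (C mu x) (C nu x) (h rho x).
move: E; rewrite J addrA => /addIr ->.
by rewrite subrr.
Qed.

Variable sigma : R[i].

Definition hlow mu x : clalg := eta mu mu *: h mu x.
Definition Bpot mu x : clalg := sigma *: hlow mu x + C mu x.
Definition Gfield mu nu x : clalg :=
  pd mu (Bpot nu) x - pd nu (Bpot mu) x - comm (Bpot mu x) (Bpot nu x).

Lemma Bpot_is_clderive mu nu x : is_clderive x mu (Bpot nu)
  (sigma *: comm (C mu x) (hlow nu x) + pd mu (C nu) x).
Proof.
apply: is_clderiveD (C_is_clderive _ _ _).
rewrite /hlow commZr; apply: is_clderiveZ; apply: is_clderiveZ.
exact: h_is_clderive.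
Qed.

(** The derivatives of sigma h give mixed terms sigma [C, h] that cancel those of [B_mu, B_nu]; the
    pure C part is the vanishing curvature of C. *)
Lemma GfieldE mu nu x :
  Gfield mu nu x = - sigma ^+ 2 *: comm (hlow mu x) (hlow nu x).
Proof.
rewrite /Gfield !(is_clderive_pd (Bpot_is_clderive _ _ _)) /Bpot.
move: (connection_flat mu nu x) => /eqP; rewrite subr_eq0 subr_eq => /eqP ->.
rewrite !(commDl, commDr, commZl, commZr).
rewrite [comm (h mu x) (C nu x)]commC.
by apply/ffunP => A; rewrite !(clalgDE, clalgNE, clalgZE); ring.
Qed.

Lemma raised_Gfield mu nu x : (eta mu mu * eta nu nu) *: Gfield mu nu x =
  - sigma ^+ 2 *: comm (h mu x) (h nu x).
Proof.
rewrite GfieldE /hlow commZl commZr !scalerA; congr (_ *: _).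
transitivity (- sigma ^+ 2 * eta mu mu ^+ 2 * eta nu nu ^+ 2); first by ring.
by rewrite !eta_sqr !mulr1.
Qed.

(** Anticommutation gives [h^mu, h^nu] = 2 h^mu h^nu; the outer commutator doubles again, and h_mu
    h^mu = e. *)
Lemma comm_hlow_h mu nu x : mu != nu ->
  comm (hlow mu x) (comm (h mu x) (h nu x)) = 4%:R *: h nu x.
Proof.
move=> munu; have swap := h_swap (h_anticomm x) munu.
have sqr := h_sqr (h_anticomm x) mu.
set a := h mu x in swap sqr *; set b := h nu x in swap *.
have aab : a * (a * b) = eta mu mu *: b by rewrite mulrA sqr -scalerAl mul1r.
have baa : b * a * a = eta mu mu *: b by rewrite -mulrA sqr -scalerAr mulr1.
have aba : a * b * a = - (eta mu mu *: b) by rewrite swap mulNr baa.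
rewrite /hlow -/a commZl /comm mulrBr mulrBl aab [a * (b * a)]mulrA aba baa.
have := eta_sqr R mu; rewrite expr2 => e2.
apply/ffunP => A; rewrite !(clalgDE, clalgNE, clalgZE).
transitivity (eta mu mu * eta mu mu * (4 * b A)); first by ring.
by rewrite e2 mul1r.
Qed.

(** A single summand, for fixed mu. By the Jacobi identity the derivative is the commutator with
    C_mu, so only sigma h_mu survives from B_mu, and - sigma times - sigma^2 gives sigma^3.
    Existence of the derivative is kept for the later conjugation by S. *)
Lemma yang_mills mu nu x :
  exists2 dG, is_clderive x mu
    (fun y => (eta mu mu * eta nu nu) *: Gfield mu nu y) dG &
  dG - comm (Bpot mu x) ((eta mu mu * eta nu nu) *: Gfield mu nu x) =
  if mu == nu then 0 else (4%:R * sigma ^+ 3) *: h nu x.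
Proof.
have -> : (fun y => (eta mu mu * eta nu nu) *: Gfield mu nu y) =
    (fun y => - sigma ^+ 2 *: comm (h mu y) (h nu y)).
  by apply/funext => y; exact: raised_Gfield.
exists (- sigma ^+ 2 *: (comm (comm (C mu x) (h mu x)) (h nu x) +
                         comm (h mu x) (comm (C mu x) (h nu x)))).
  apply: is_clderiveZ.
  exact: is_clderive_comm (h_is_clderive _ _ _) (h_is_clderive _ _ _).
rewrite raised_Gfield -comm_jacobi commZr -scalerBr /Bpot commDl opprD addrCA.
rewrite subrr addr0 commZl scalerN scalerA mulNr scaleNr opprK -exprSr.
case: eqVneq => [->|munu]; last by rewrite comm_hlow_h // scalerA mulrC.
by rewrite {2}/comm subrr /comm mulr0 mul0r subrr scaler0.
Qed.

Lemma sum_offdiag nu (c : R[i]) (U : clalg) :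
  \sum_(mu < n) (if mu == nu then 0 else c *: U) = (n.-1%:R * c) *: U.
Proof.
rewrite (bigD1 nu) //= eqxx add0r.
rewrite (eq_bigr (fun=> c *: U)); last by move=> mu /negbTE->.
rewrite sumr_const -scaler_nat scalerA; congr (_%:R * _ *: _).
have := cardC1 nu; rewrite card_ord => <-.
by apply: eq_card => mu; rewrite !inE.
Qed.

End ParallelCliffordField.

(** * Translation between [Cl] and [clalg] *)

Section Transfer.
Variables (R : realType) (p q : nat).
Local Notation n := (p + q)%N.
Local Notation V := 'rV[R]_n.
Local Notation eta := (@Defs.eta R p q).
Implicit Types (U W : Cl R p q) (c : R[i]).

(** The two sides use different additions on the same elements: pointwise on [Cl], locked on
    [clalg]. The equality is proved because it cannot be seen by conversion. *)
Lemma cl_addE U W : U + W = (U : clalg R p q) + (W : clalg R p q).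
Proof. by apply/ffunP => A; rewrite ffunE clalgDE. Qed.

Lemma cl_subE U W : U - W = (U : clalg R p q) - (W : clalg R p q).
Proof. by apply/ffunP => A; rewrite !ffunE clalgDE clalgNE. Qed.

Lemma cl_scaleE c U : c *: U = c *: (U : clalg R p q).
Proof. by apply/ffunP => A; rewrite ffunE clalgZE. Qed.

Lemma cl_commE U W : clcomm U W = comm U W.
Proof. by rewrite /clcomm cl_subE /comm !clalgME. Qed.

Lemma cl_pdE (mu : 'I_n) (F : V -> Cl R p q) : pd mu F = clpd mu F.
Proof. by []. Qed.

Lemma cl0E : (0 : Cl R p q) = (0 : clalg R p q).
Proof. by apply/ffunP => A; rewrite ffunE clalg0E. Qed.

Lemma cl_sumE I (r : seq I) (P : pred I) (F : I -> Cl R p q) :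
  \sum_(i <- r | P i) F i = \sum_(i <- r | P i) (F i : clalg R p q).
Proof. by elim/big_rec2: _ => [|i x y _ ->]; rewrite ?cl0E ?cl_addE. Qed.

Lemma cl_conjE U W X : clmul (clmul U W) X = clconj U W X.
Proof. by rewrite /clconj !clalgME. Qed.

Lemma lower1E (F : 'I_n -> V -> Cl R p q) mu x :
  lower1 F mu x = eta mu mu *: (F mu x : clalg R p q).
Proof.
rewrite /lower1 cl_sumE (bigD1 mu) //= big1 ?addr0 ?cl_scaleE // => nu numu.
by rewrite eta_eq0 1?eq_sym // cl_scaleE scale0r.
Qed.

Lemma raise2E (G : 'I_n -> 'I_n -> V -> Cl R p q) mu nu x :
  raise2 G mu nu x = (eta mu mu * eta nu nu) *: (G mu nu x : clalg R p q).
Proof.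
rewrite /raise2 cl_sumE.
rewrite (eq_bigr (fun a => (eta mu a * eta nu nu) *: (G a nu x : clalg R p q))).
  rewrite (bigD1 mu) //= big1 ?addr0 // => a amu.
  by rewrite [eta mu a]eta_eq0 1?eq_sym // mul0r scale0r.
move=> a _; rewrite cl_sumE (bigD1 nu) //= big1 ?addr0 ?cl_scaleE // => b bnu.
by rewrite [eta nu b]eta_eq0 1?eq_sym // mulr0 cl_scaleE scale0r.
Qed.

End Transfer.

Theorem theorem10 (R : realType) (p q : nat)
  (h C : 'I_(p + q) -> 'rV[R]_(p + q) -> Cl R p q)
  (sigma : R[i])
  (S Sinv : 'rV[R]_(p + q) -> Cl R p q) :
  clifford_field_vector h ->
  (forall mu x, in_ClS (h mu x)) ->
  (forall mu x, in_ClS (C mu x)) ->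
  (forall mu, clC2 (h mu)) ->
  (forall mu, clC2 (C mu)) ->
  (forall mu rho x,
      pd mu (lower1 h rho) x - clcomm (C mu x) (lower1 h rho x) = 0) ->
  clsmooth S ->
  (forall x, clmul (S x) (Sinv x) = clone R p q /\
             clmul (Sinv x) (S x) = clone R p q) ->
  (forall mu x, in_ClS (clmul (Sinv x) (pd mu S x))) ->
  let eps : R[i] := (4 * (p + q).-1)%:R * sigma ^+ 3 in
  let B := fun mu x => sigma *: lower1 h mu x + C mu x in
  let G := fun mu nu x =>
      pd mu (B nu) x - pd nu (B mu) x - clcomm (B mu x) (B nu x) in
  let conj := fun (X : 'rV[R]_(p + q) -> Cl R p q) x =>
      clmul (clmul (Sinv x) (X x)) (S x) in
  let B' := fun mu x => conj (B mu) x - clmul (Sinv x) (pd mu S x) in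
  let G' := fun mu nu => conj (G mu nu) in
  let h' := fun nu => conj (h nu) in
  let C' := fun mu x => conj (C mu) x - clmul (Sinv x) (pd mu S x) in
  (forall mu x, B' mu x = sigma *: lower1 h' mu x + C' mu x) /\
  (forall mu nu x,
      pd mu (B' nu) x - pd nu (B' mu) x - clcomm (B' mu x) (B' nu x)
      = G' mu nu x) /\
  (forall nu x,
      \sum_(mu < p + q)
        (pd mu (raise2 G' mu nu) x - clcomm (B' mu x) (raise2 G' mu nu x))
      = eps *: h' nu x).
Proof.
move=> hcfv _ CS hC2 CC2 hpar smS SSinv _ eps B G conj B' G' h' C'.
pose cl (F : 'rV[R]_(p + q) -> Cl R p q) : 'rV[R]_(p + q) -> clalg R p q := F.
have anti x mu nu : cl (h mu) x * cl (h nu) x + cl (h nu) x * cl (h mu) x =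
    (2%:R * Defs.eta R mu nu) *: 1.
  by have := (hcfv x).1 mu nu; rewrite cl_addE cl_scaleE !clalgME clalg_oneE.
have Trh x : (\prod_mu cl (h mu) x) finset.set0 = 0.
  rewrite -[RHS](hcfv x).2 /clTr; congr (fun_of_fin _ _).
  by apply: (big_ind2 (fun U W => U = W :> clalg R p q))
      => [|U1 U2 W1 W2 -> ->|];
    rewrite ?clalg_oneE ?clalgME.
have par mu rho x : clpd mu (cl (h rho)) x = comm (cl (C mu) x) (cl (h rho) x).
  have := hpar mu rho x; rewrite lower1E.
  have -> : lower1 h rho = fun y => Defs.eta R rho rho *: cl (h rho) y.
    by apply/funext => y; rewrite lower1E.
  have dh := clC2_is_clderive x mu (hC2 rho).
  rewrite cl_pdE (is_clderive_pd (is_clderiveZ _ dh)).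
  rewrite cl_subE cl_commE commZr -scalerBr cl0E.
  (* The hypothesis concerns h_rho; as [eta rho rho] squares to 1, this multiplication raises the
     index. *)
  move=> /(congr1 (fun U : clalg R p q => Defs.eta R rho rho *: U)).
  by rewrite scalerA -expr2 eta_sqr scale1r scaler0; exact: subr0_eq.
have ST y : cl S y * cl Sinv y = 1 by rewrite clalgME (SSinv y).1 clalg_oneE.
have TS y : cl Sinv y * cl S y = 1 by rewrite clalgME (SSinv y).2 clalg_oneE.
have SC2 := clsmooth_clC2 smS.
have BE mu : B mu = Bpot h C sigma mu.
  by apply/funext => x; rewrite /B cl_addE cl_scaleE lower1E.
have GE mu nu x : G mu nu x = Gfield h C sigma mu nu x.
  by rewrite /G !BE !cl_pdE !cl_subE cl_commE.
have B'E mu : B' mu = fun y => clconj (cl Sinv y) (Bpot h C sigma mu y) (cl S y)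
    - cl Sinv y * clpd mu S y.
  by apply/funext => x; rewrite /B' /conj BE cl_conjE cl_subE clalgME.
split=> [mu x|].
  rewrite B'E cl_addE cl_scaleE lower1E /C' /h' /conj cl_subE !cl_conjE clalgME.
  by rewrite /Bpot /hlow clconjD !clconjZ addrA.
split=> [mu nu x|nu x].
  have dS a := clC2_is_clderive x a SC2.
  have ddS a b := clC2_is_clderive2 x a b SC2.
  (* Symmetry of the second derivatives of S supplies the common value that [curvature_clconj]
     expects. *)
  have := ddS mu nu; rewrite (clC2_pd_comm mu nu SC2) => ddS'.
  have dB a b := Bpot_is_clderive hC2 CC2 par sigma a b x.
  have [dBn' [dBm' [Dn Dm E]]] := curvature_clconj ST TS
    (dS mu) (dS nu) (ddS nu mu) ddS' (dB mu nu) (dB nu mu).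
  rewrite /G' /conj cl_conjE GE !cl_pdE !B'E.
  rewrite (is_clderive_pd Dn) (is_clderive_pd Dm).
  rewrite !cl_subE cl_commE E /Gfield.
  by rewrite !(is_clderive_pd (dB _ _)).
(* The contribution of mu before conjugation; conjugation by S is linear and can be taken out of the
   sum. *)
pose K := fun mu : 'I_(p + q) => if mu == nu then 0 : clalg R p q
  else (4%:R * sigma ^+ 3) *: cl (h nu) x.
rewrite cl_sumE cl_scaleE.
have term mu :
    pd mu (raise2 G' mu nu) x - clcomm (B' mu x) (raise2 G' mu nu x) =
    clconj (cl Sinv x) (K mu) (cl S x).
  have [dG GD E] := yang_mills anti Trh hC2 CS CC2 par sigma mu nu x.
  have [dG' GD' E'] := covderiv_clconj ST TS (Bpot h C sigma mu)
    (clC2_is_clderive x mu SC2) GD.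
  have RE : raise2 G' mu nu = fun y => clconj (cl Sinv y)
      ((Defs.eta R mu mu * Defs.eta R nu nu) *: Gfield h C sigma mu nu y)
      (cl S y).
    apply/funext => y; rewrite raise2E /G' /conj cl_conjE GE.
    by rewrite clconjZ.
  by rewrite RE cl_pdE (is_clderive_pd GD') cl_subE cl_commE B'E E' E.
transitivity (clconj (cl Sinv x) (\sum_mu K mu) (cl S x)).
  by rewrite /clconj mulr_sumr mulr_suml; apply: eq_bigr => mu _; exact: term.
rewrite sum_offdiag clconjZ /h' /conj cl_conjE /eps.
by rewrite mulrA [_%:R * 4%:R]mulrC natrM.
Qed.
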